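(* Let $n \ge 1$. There exist constants $C_n > 0$ and $\alpha_n \in (0,1)$, depending only on $n$, such that the following holds. Let $U_1, \ldots, U_n$ be a collection of commuting invertible measure preserving transformations on a probability space $(\Omega, \Sigma, \mu)$, and for $0<\alpha<1$ let $\mathsf{C}^*_{\mathsf{HL,c}}(\alpha)$ be the sharp Tauberian constant of the associated ergodic centered Hardy-Littlewood maximal operator $\mathsf{M}^*_{\mathsf{HL,c}}$. Then \[ \lim_{\alpha \to 1^-} \mathsf{C}^*_{\mathsf{HL,c}}(\alpha) = 1, \] and in particular \[ \mathsf{C}^*_{\mathsf{HL,c}}(\alpha) - 1 \le C_n \Big(\frac{1}{\alpha} - 1\Big) \qquad \text{for all } \alpha \in (\alpha_n, 1). \]
   Context: A measure preserving transformation $U$ is invertible if it is a bijection of $\Omega$ with $U$ and $U^{-1}$ both measurable and measure preserving; $U^{j}$ for $j<0$ denotes $(U^{-1})^{|j|}$. Let $\mathcal{B}_{\mathsf{HL,c}}$ be the collection of all open Euclidean balls in $\mathbb{R}^n$ which are centered at the origin. The ergodic centered Hardy-Littlewood maximal operator associated with $U_1,\ldots,U_n$ is defined for $f \in L^1(\Omega)$ by \[ \mathsf{M}^*_{\mathsf{HL,c}} f(\omega) = \sup_{B \in \mathcal{B}_{\mathsf{HL,c}}} \frac{1}{\#(B \cap \mathbb{Z}^n)} \sum_{(j_1,\ldots,j_n) \in B \cap \mathbb{Z}^n} |f(U_1^{j_1} \cdots U_n^{j_n}\omega)|, \qquad \omega \in \Omega. \] For $0<\alpha<1$, the sharp Tauberian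 constant is \[ \mathsf{C}^*_{\mathsf{HL,c}}(\alpha) = \sup_{E \in \Sigma,\ \mu(E)>0} \frac{1}{\mu(E)}\, \mu(\{\omega \in \Omega : \mathsf{M}^*_{\mathsf{HL,c}} \chi_E(\omega) > \alpha\}), \] where $\chi_E$ is the indicator function of $E$. *)

(* Defs.v *)
From HB Require Import structures.
From mathcomp Require Import all_boot all_order all_algebra finmap.
From mathcomp Require Import all_classical all_reals all_analysis.
From mathcomp Require Import zify.

Set Implicit Arguments.
Unset Strict Implicit.
Unset Printing Implicit Defensive.

Import Order.TTheory GRing.Theory Num.Theory.
Import numFieldNormedType.Exports.

Local Open Scope classical_set_scope.
Local Open Scope ring_scope.

Definition measure_preserving d (T : measurableType d) (R : realType)
    (mu : set T -> \bar R) (U : T -> T) : Prop :=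
  measurable_fun setT U /\
  forall A : set T, measurable A -> mu (U @^-1` A) = mu A.

Record invertible_mpt d (T : measurableType d) (R : realType)
    (mu : set T -> \bar R) := InvertibleMpt {
  mpt_fun :> T -> T;
  mpt_inv : T -> T;
  mpt_funK : cancel mpt_fun mpt_inv;
  mpt_invK : cancel mpt_inv mpt_fun;
  mpt_fun_preserving : measure_preserving mu mpt_fun;
  mpt_inv_preserving : measure_preserving mu mpt_inv }.

(* [Negz k] is the integer [- k.+1]. *)
Definition mpt_pow d (T : measurableType d) (R : realType)
    (mu : set T -> \bar R) (U : invertible_mpt mu) (j : int) : T -> T :=
  match j with
  | Posz k => iter k U
  | Negz k => iter k.+1 (mpt_inv U)
  end.

(* The composite of the [mpt_pow (U i) (j 0 i)], the one of index 0 being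
   applied last. *)
Definition mpt_monomial d (T : measurableType d) (R : realType)
    (mu : set T -> \bar R) (n : nat) (U : 'I_n -> invertible_mpt mu)
    (j : 'rV[int]_n) : T -> T :=
  \big[(fun f g : T -> T => f \o g)/id]_(i < n) mpt_pow (U i) (j 0 i).

(* The library's norm on ['rV[R]_n] is the sup norm, hence this definition. *)
Definition euclidean_norm (R : realType) (n : nat) (x : 'rV[R]_n) : R :=
  Num.sqrt (\sum_(i < n) x 0 i ^+ 2).

Definition HLc_balls (R : realType) (n : nat) : set (set 'rV[R]_n) :=
  [set B | exists2 r : R, 0 < r & B = [set x | euclidean_norm x < r]].

Definition lattice_points (R : realType) (n : nat) (B : set 'rV[R]_n) :
    set 'rV[int]_n :=
  [set j | B (map_mx intr j)].

(* [fset_set] and [\sum_(j \in _)] are only meaningful on finite sets. *)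
Lemma finite_lattice_points (R : realType) (n : nat) (B : set 'rV[R]_n) :
  HLc_balls B -> finite_set (lattice_points B).
Proof.
move=> [r r0 ->]; set N := Num.truncn r.
pose g (t : {ffun 'I_n -> 'I_(N + N).+1}) : 'rV[int]_n :=
  \row_i ((t i)%:Z - N%:Z).
apply: (@sub_finite_set _ _ (g @` setT)); last exact: finite_image.
move=> j /= jr.
have jN (i : 'I_n) : (absz (j ord0 i) <= N)%N.
  rewrite /N truncn_ge_nat ?ltW// natr_absz intr_norm; apply: le_lt_trans jr.
  rewrite -sqrtr_sqr ler_wsqrtr// (bigD1 i)//= mxE lerDl.
  by apply: sumr_ge0 => k _; exact: sqr_ge0.
exists [ffun i => inord (absz (j ord0 i + N%:Z))] => //.
apply/rowP => i; rewrite mxE ffunE inordK; last by have := jN i; lia.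
by rewrite gez0_abs ?addrK//; have := jN i; lia.
Qed.

Definition ergodic_avg d (T : measurableType d) (R : realType)
    (mu : set T -> \bar R) (n : nat) (U : 'I_n -> invertible_mpt mu)
    (f : T -> R) (B : set 'rV[R]_n) (w : T) : R :=
  (#|` fset_set (lattice_points B)|%fset)%:R^-1 *
  \sum_(j \in lattice_points B) `|f (mpt_monomial U j w)|.

Definition ergodic_maximal_HLc d (T : measurableType d) (R : realType)
    (mu : set T -> \bar R) (n : nat) (U : 'I_n -> invertible_mpt mu)
    (f : T -> R) (w : T) : \bar R :=
  ereal_sup [set (ergodic_avg U f B w)%:E | B in @HLc_balls R n].

Definition tauberian_HLc d (T : measurableType d) (R : realType)
    (mu : set T -> \bar R) (n : nat) (U : 'I_n -> invertible_mpt mu)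
    (alpha : R) : \bar R :=
  ereal_sup
    [set (mu [set w | alpha%:E < ergodic_maximal_HLc U \1_E w] / mu E)%E
    | E in [set E : set T | measurable E /\ (0 < mu E)%E]].

(* Main.v *)
(* If the maximal function of the indicator of E exceeds alpha along the orbit
   at a lattice point x, some ball B centered at x satisfies
   #(B \ E) < (1/alpha - 1) #(B /\ E). A Besicovitch subfamily of such balls
   covers these points with overlap at most K, and summing over it shows that
   the points outside E are at most K (1/alpha - 1) #E in number. Averaging
   over Omega the counts along orbit segments indexed by large boxes
   (Calderon's transference) turns this into
   mu({M 1_E > alpha} \ E) <= K (1/alpha - 1) mu(E). *)
Require Import Defs.
From mathcomp Require Import all_boot all_order all_algebra finmap.
From mathcomp Require Import all_classical all_reals all_analysis measurable_realfun.
From mathcomp Require Import zify ring lra.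

Set Implicit Arguments.
Unset Strict Implicit.
Unset Printing Implicit Defensive.

Import Order.TTheory GRing.Theory Num.Theory.
Import numFieldNormedType.Exports.
Local Open Scope classical_set_scope.
Local Open Scope ring_scope.

(** * Euclidean norm and angles between vectors *)

Lemma euclidean_norm_ge0 (R : realType) n (x : 'rV[R]_n) :
  0 <= euclidean_norm x.
Proof. exact: sqrtr_ge0. Qed.

Lemma sqr_euclidean_norm (R : realType) n (x : 'rV[R]_n) :
  euclidean_norm x ^+ 2 = \sum_(i < n) x 0 i ^+ 2.
Proof. by rewrite sqr_sqrtr// sumr_ge0// => i _; exact: sqr_ge0. Qed.

Lemma euclidean_distC (R : realType) n (x y : 'rV[R]_n) :
  euclidean_norm (x - y) = euclidean_norm (y - x).
Proof.
congr Num.sqrt; apply: eq_bigr => i _.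
by rewrite -[x - y]opprB mxE sqrrN.
Qed.

Lemma euclidean_dist0 (R : realType) n (x : 'rV[R]_n) :
  euclidean_norm (x - x) = 0.
Proof.
by rewrite /euclidean_norm subrr big1 ?sqrtr0// => i _; rewrite mxE expr0n.
Qed.

Lemma ler_coord_euclidean_norm (R : realType) n (x : 'rV[R]_n) i :
  `|x 0 i| <= euclidean_norm x.
Proof.
rewrite -sqrtr_sqr ler_wsqrtr// (bigD1 i)//= lerDl.
by apply: sumr_ge0 => k _; exact: sqr_ge0.
Qed.

Lemma euclidean_norm_gt0 (R : realType) n (x : 'rV[R]_n) :
  x != 0 -> 0 < euclidean_norm x.
Proof.
apply: contraNT; rewrite -leNgt => x0; apply/eqP/rowP => i; rewrite mxE.
by apply/eqP; rewrite -normr_le0 (le_trans _ x0)// ler_coord_euclidean_norm.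
Qed.

(* Two vectors which are closer to the origin than to one another form an
   angle of more than 60 degrees, so their directions differ by more than 1. *)
Lemma far_directions (R : realType) n (u v : 'rV[R]_n) :
  u != 0 -> v != 0 ->
  euclidean_norm u < euclidean_norm (u - v) ->
  euclidean_norm v < euclidean_norm (u - v) ->
  1 < \sum_(i < n) (u 0 i / euclidean_norm u - v 0 i / euclidean_norm v) ^+ 2.
Proof.
move=> /euclidean_norm_gt0 u0 /euclidean_norm_gt0 v0 uw vw.
have {}uw : euclidean_norm u ^+ 2 < euclidean_norm (u - v) ^+ 2.
  by rewrite ltr_pXn2r ?nnegrE ?euclidean_norm_ge0.
have {}vw : euclidean_norm v ^+ 2 < euclidean_norm (u - v) ^+ 2.
  by rewrite ltr_pXn2r ?nnegrE ?euclidean_norm_ge0.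
set a := euclidean_norm u in u0 uw *; set b := euclidean_norm v in v0 vw *.
(* [D] is the cosine of the angle between [u] and [v]; the sum to bound is 2 - 2 [D], so the goal
   amounts to [D] < 1/2. *)
pose D := \sum_(i < n) (u 0 i / a) * (v 0 i / b).
have aE : \sum_(i < n) (u 0 i / a) ^+ 2 = 1.
  under eq_bigr do rewrite exprMn.
  rewrite -mulr_suml -sqr_euclidean_norm -exprMn divff ?expr1n//.
  by rewrite gt_eqF.
have bE : \sum_(i < n) (v 0 i / b) ^+ 2 = 1.
  under eq_bigr do rewrite exprMn.
  rewrite -mulr_suml -sqr_euclidean_norm -exprMn divff ?expr1n//.
  by rewrite gt_eqF.
have -> : \sum_(i < n) (u 0 i / a - v 0 i / b) ^+ 2 = 1 + 1 - 2 * D.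
  rewrite -[X in X + _ - _]aE -[X in _ + X - _]bE /D mulr_sumr -big_split -sumrB/=.
  by apply: eq_bigr => i _; ring.
have wE : euclidean_norm (u - v) ^+ 2 = a ^+ 2 + b ^+ 2 - 2 * (a * b * D).
  rewrite 3!sqr_euclidean_norm /D mulr_sumr mulr_sumr -big_split -sumrB/=.
  by apply: eq_bigr => i _; rewrite !mxE; field; rewrite !gt_eqF.
have /= : D < 2^-1; last lra.
rewrite wE in uw vw.
have ab0 : 0 < a * b by rewrite mulr_gt0.
(* If [D] were at least 1/2, the law of cosines [wE] would bound the squared distance by a^2 + b^2 -
   ab, hence by the larger of a^2 and b^2. *)
rewrite ltNge; apply/negP => D2.
have h : a * b <= 2 * (a * b * D) by nra.
have [ab|ba] := leP a b; nra.
Qed.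

(** * Besicovitch covering for finite families of balls *)

(** Greedy choice: keep a ball of largest radius, drop the points whose centers it contains, and
    recurse on the others. A center kept later is at least the earlier radius away, and that radius
    is the larger of the two, so the separation holds in both orders. *)
Lemma besicovitch_selection (R : realType) n (T : eqType) (c : T -> 'rV[R]_n)
    (r : T -> R) (s : seq T) :
  {in s, forall x, 0 < r x} ->
  exists t : seq T, [/\ uniq t, {subset t <= s},
    {in s, forall x, exists2 y, y \in t & euclidean_norm (c x - c y) < r y} &
    {in t &, forall x y, x != y -> r x <= euclidean_norm (c x - c y)}].
Proof.
have [m] := ubnP (size s); elim: m s => // m IHm [|a s'] sm r0.
  by exists [::].
set s := a :: s' in sm r0 *.
have [x xs xmax] : exists2 x, x \in s & {in s, forall y, r y <= r x}.
  rewrite /s; clear s sm r0; elim: s' => [|b s' IHs].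
    by exists a; rewrite ?mem_head// => y; rewrite inE => /eqP ->.
  have [x xs xmax] := IHs.
  have [xb|bx] := leP (r x) (r b).
    exists b; rewrite ?inE ?eqxx ?orbT// => y; rewrite !inE.
    move=> /or3P[ys|/eqP ->//|ys].
      by apply: le_trans xb; apply: xmax; rewrite inE ys.
    by apply: le_trans xb; apply: xmax; rewrite inE ys orbT.
  exists x; first by move: xs; rewrite !inE => /orP[->//|->]; rewrite !orbT.
  move=> y; rewrite !inE => /or3P[ys|/eqP ->|ys]; last 2 first.
  - exact: ltW.
  - by apply: xmax; rewrite inE ys orbT.
  - by apply: xmax; rewrite inE ys.
pose far := [pred y | r x <= euclidean_norm (c y - c x)].
have xfar : ~~ far x by rewrite /= euclidean_dist0 -ltNge r0.
have [||t [ut ts tc tsep]] := IHm [seq y <- s | far y].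
- apply: leq_trans (_ : size s <= m)%N => //.
  rewrite size_filter -(count_predC far s) -addn1 leq_add2l -has_count.
  by apply/hasP; exists x.
- by move=> y; rewrite mem_filter => /andP[_]; exact: r0.
have tfar y : y \in t -> far y /\ y \in s.
  by move=> /ts; rewrite mem_filter => /andP.
exists (x :: t); split.
- by rewrite /= ut andbT; apply: contra xfar => /tfar[].
- by move=> y; rewrite inE => /orP[/eqP ->//|/tfar[]].
- move=> y ys; have [yfar|] := boolP (far y).
    have [|z zt yz] := tc y; first by rewrite mem_filter yfar.
    by exists z => //; rewrite inE zt orbT.
  by rewrite /= -ltNge => yx; exists x; rewrite ?mem_head.
- move=> y z; rewrite !inE => /orP[/eqP ->|yt] /orP[/eqP ->|zt] yz.
  + by rewrite eqxx in yz.
  + by rewrite euclidean_distC; exact: (tfar _ zt).1.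
  + by apply: le_trans (tfar _ yt).1; apply: xmax; exact: (tfar _ yt).2.
  + exact: tsep.
Qed.

(* Balls through [p] whose centers are separated in this way are seen from [p]
   in directions at distance more than 1, whence at most one direction in each
   cell of the partition of [-1, 1]^n into cubes of side 1/n. *)
Lemma besicovitch_overlap (R : realType) n (T : eqType) (c : T -> 'rV[R]_n)
    (r : T -> R) (t : seq T) (p : 'rV[R]_n) : (0 < n)%N -> uniq t ->
  {in t &, forall x y, x != y -> r x <= euclidean_norm (c x - c y)} ->
  (count [pred x | (euclidean_norm (p - c x) < r x)%R] t <= (2 * n).+1 ^ n)%N.
Proof.
move=> n0 ut tsep; rewrite -size_filter; set P := [pred x | _].
set s := [seq x <- t | P x].
have us : uniq s by rewrite filter_uniq.
have sP x : x \in s -> euclidean_norm (p - c x) < r x.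
  by rewrite mem_filter => /andP[].
have ssep x y : x \in s -> y \in s -> x != y ->
    r x <= euclidean_norm (c x - c y).
  by rewrite !mem_filter => /andP[_ xt] /andP[_ yt]; exact: tsep.
(* A center equal to [p] has no direction from [p]. But any other ball through [p] would then
   contain this center, against separation, so there is only one ball. *)
have [/hasP[x xs /eqP cxp]|/hasPn cp] := boolP (has (fun x => c x == p) s).
  apply: (@leq_trans (size [:: x])); last by rewrite expn_gt0.
  apply: uniq_leq_size => // y ys; rewrite inE; apply: contraT => yx.
  by have := ssep _ _ ys xs yx; rewrite leNgt euclidean_distC cxp sP.
(* Direction coordinates are rescaled from [-1, 1] to [0, 2n], so that truncation indexes the cubes
   of side 1/n. The extra index 2n is taken by a coordinate equal to 1. *)
pose w x i : R := n%:R * ((p - c x) 0 i / euclidean_norm (p - c x) + 1).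
have pc0 x : x \in s -> p - c x != 0.
  by move=> /cp; rewrite subr_eq0 eq_sym.
have wE x i : x \in s -> 0 <= w x i <= (2 * n)%:R.
  move=> xs; have a0 := euclidean_norm_gt0 (pc0 x xs).
  have : `|(p - c x) 0 i / euclidean_norm (p - c x)| <= 1.
    rewrite normrM normfV (gtr0_norm a0) ler_pdivrMr// mul1r.
    exact: ler_coord_euclidean_norm.
  rewrite ler_norml => /andP[h1 h2].
  have nR : 0 <= n%:R :> R by [].
  rewrite /w natrM; set z := _ / _ in h1 h2 *; nra.
pose cell x : {ffun 'I_n -> 'I_(2 * n).+1} :=
  [ffun i => inord (Num.truncn (w x i))].
have cell_inj : {in s &, injective cell}.
  move=> x y xs ys /ffunP xy; apply/eqP/negPn/negP => yx.
  have xyE : p - c x - (p - c y) = c y - c x.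
    by rewrite opprB addrC addrA subrK.
  have : 1 < \sum_(i < n) ((p - c x) 0 i / euclidean_norm (p - c x) -
                           (p - c y) 0 i / euclidean_norm (p - c y)) ^+ 2.
    apply: far_directions; rewrite ?pc0// xyE.
      by rewrite (lt_le_trans (sP _ xs))// euclidean_distC ssep.
    by rewrite (lt_le_trans (sP _ ys))// ssep// eq_sym.
  apply/negP; rewrite -leNgt.
  (* Coordinates in a common cell differ by at most 1/n, so each square is at most 1/n and the n
     squares sum to at most 1. *)
  apply: (@le_trans _ _ (\sum_(i < n) n%:R^-1)); last first.
    by rewrite sumr_const card_ord -[_ *+ _]mulr_natl divff// pnatr_eq0 -lt0n.
  apply: ler_sum => i _.
  have /andP[x0 x1] := wE x i xs; have /andP[y0 y1] := wE y i ys.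
  have := xy i; rewrite !ffunE => /(congr1 (@nat_of_ord _)).
  rewrite !inordK ?ltnS; last 2 first.
    by rewrite -(ler_nat R) (le_trans _ y1)// truncn_le.
    by rewrite -(ler_nat R) (le_trans _ x1)// truncn_le.
  move=> e; have := truncn_itv x0; have := truncn_itv y0; rewrite -e -natr1.
  set m := (Num.truncn _)%:R => /andP[m1 m2] /andP[m3 m4].
  have {m1 m2 m3 m4} : `|w x i - w y i| <= 1 by rewrite ler_norml; lra.
  rewrite /w; set a := _ / _; set b := _ / _.
  have nR : 1 <= n%:R :> R by rewrite ler1n.
  have nR0 : 0 < n%:R :> R by lra.
  rewrite -mulrBr opprD addrACA subrr addr0 normrM gtr0_norm// => h.
  have h' : `|a - b| <= n%:R^-1.
    by rewrite -[leRHS]mulr1 mulrC ler_pdivlMr// mulrC.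
  rewrite -real_normK ?num_real// -[leRHS]mulr1 expr2 ler_pM//.
  by rewrite (le_trans h')// invf_le1.
have ucell : uniq (map cell s) by rewrite map_inj_in_uniq.
rewrite -(size_map cell) -(card_uniqP ucell).
by apply: leq_trans (max_card _) _; rewrite card_ffun !card_ord.
Qed.

(** * The Tauberian estimate on the integer lattice *)

Definition origin_ball (R : realType) n (r : R) : set 'rV[R]_n :=
  [set x | euclidean_norm x < r].

Definition ball_fset (R : realType) n (r : R) : {fset 'rV[int]_n} :=
  fset_set (lattice_points (@origin_ball R n r)).

Lemma HLc_origin_ball (R : realType) n (r : R) :
  0 < r -> HLc_balls (@origin_ball R n r).
Proof. by move=> r0; exists r. Qed.

Lemma mem_ball_fset (R : realType) n (r : R) (k : 'rV[int]_n) : 0 < r ->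
  (k \in ball_fset n r) = (euclidean_norm (map_mx intr k : 'rV[R]_n) < r).
Proof.
move=> /(HLc_origin_ball n)/finite_lattice_points fr.
by rewrite in_fset_set//; apply/idP/idP; rewrite inE.
Qed.

(* The constant [(2 n + 1)^n] is the overlap bound of Besicovitch's theorem. *)
Lemma lattice_tauberian (R : realType) n (alpha : R) (e : pred 'rV[int]_n)
    (s q : seq 'rV[int]_n) :
  (0 < n)%N -> 0 < alpha -> alpha < 1 -> uniq s -> uniq q ->
  {in s, forall x, ~~ e x /\ exists r : R,
    [/\ 0 < r, {in ball_fset n r, forall k, x + k \in q} &
      alpha * #|` ball_fset n r|%:R <
        (count (fun k => e (x + k)) (ball_fset n r))%:R]} ->
  (size s)%:R <= ((2 * n).+1 ^ n)%:R * (alpha^-1 - 1) * (count e q)%:R :> R.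
Proof.
move=> n0 a0 a1 us uq hs.
have /choice[r rP] : forall x, exists r : R, x \in s ->
    [/\ 0 < r, {in ball_fset n r, forall k, x + k \in q} &
      alpha * #|` ball_fset n r|%:R <
        (count (fun k => e (x + k)) (ball_fset n r))%:R].
  move=> x; have [/hs[_ [r rP]]|] := boolP (x \in s); first by exists r.
  (* A dummy radius outside [s]; the selected centers all lie in [s]. *)
  by exists 0.
pose c (x : 'rV[int]_n) : 'rV[R]_n := map_mx intr x.
have cB x y : c (x - y) = c x - c y by rewrite /c raddfB.
have [|t [ut ts tc tsep]] := @besicovitch_selection R n _ c r s.
  by move=> x /rP[].
pose F x := ball_fset n (r x).
have FE x k : x \in s -> (k \in F x) = (euclidean_norm (c k) < r x).
  by move=> /rP[? _ _]; rewrite mem_ball_fset.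
(* Every point of [s] violates [e] and lies in a selected ball, so it is among the points counted on
   the right. *)
have st : (size s <= \sum_(x <- t) count (fun k => ~~ e (x + k)%R) (F x))%N.
  pose w x := [seq x + k | k <- F x & ~~ e (x + k)].
  have -> : (\sum_(x <- t) count (fun k => ~~ e (x + k)%R) (F x) =
             size (flatten (map w t)))%N.
    rewrite size_flatten sumnE !big_map; apply: eq_bigr => x _.
    by rewrite size_map size_filter.
  apply: uniq_leq_size => // y ys; have [x xt yx] := tc y ys.
  apply/flattenP; exists (w x); first exact: map_f.
  apply/mapP; exists (y - x); last by rewrite addrC subrK.
  by rewrite mem_filter addrC subrK (hs _ ys).1 FE ?ts// cB.
(* Double counting: after exchanging the sums, each point of [q] satisfying [e] is counted once per
   selected ball containing it, which the overlap bound controls. *)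
have tq : (\sum_(x <- t) count (fun k => e (x + k)%R) (F x) <=
           (2 * n).+1 ^ n * count e q)%N.
  apply: (@leq_trans (\sum_(x <- t) \sum_(y <- q | e y)
      (euclidean_norm (c y - c x) < r x)%R)%N).
    rewrite big_seq [leqRHS]big_seq; apply: leq_sum => x xt.
    rewrite -big_mkcondr/= sum1_count -2!size_filter.
    rewrite -(size_map (fun k => x + k)); apply: uniq_leq_size.
      rewrite map_inj_uniq ?filter_uniq ?fset_uniq//; exact: addrI.
    move=> _ /mapP[k + ->]; rewrite !mem_filter => /andP[ek kF].
    rewrite /= ek -cB addrAC subrr add0r -FE ?ts// kF/=.
    by have [_ + _] := rP _ (ts _ xt); exact.
  rewrite exchange_big/= mulnC -sum1_count big_distrl/=.
  apply: leq_sum => y _; rewrite mul1n.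
  apply: leq_trans (besicovitch_overlap (c y) n0 ut tsep).
  by rewrite -sum1_count [leqRHS]big_mkcond leq_sum// => x _; case: ifP.
have b0 : 0 < alpha^-1 - 1 by rewrite subr_gt0 invf_gt1.
rewrite mulrAC -natrM mulrC.
apply: (@le_trans _ _ ((alpha^-1 - 1) *
    (\sum_(x <- t) count (fun k => e (x + k)%R) (F x))%:R)); last first.
  by rewrite ler_pM2l// ler_nat.
apply: (@le_trans _ _ (\sum_(x <- t) count (fun k => ~~ e (x + k)%R) (F x))%:R).
  by rewrite ler_nat.
(* Ball by ball: with u points in [e] and v outside, alpha (u + v) < u gives v < (1/alpha - 1) u. *)
rewrite !natr_sum mulr_sumr big_seq [leRHS]big_seq; apply: ler_sum => x xt.
have [_ _] := rP _ (ts _ xt); rewrite -/(F x).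
have <- : (count (fun k => e (x + k)%R) (F x) +
           count (fun k => ~~ e (x + k)%R) (F x))%N = #|` F x|.
  exact: count_predC.
rewrite natrD mulrDr -ltrBrDl => h; rewrite mulrBl mul1r.
set v := _%:R in h *; set u := _%:R in h *.
have -> : v = alpha^-1 * (alpha * v) by rewrite mulKf// gt_eqF.
have -> : alpha^-1 * u - u = alpha^-1 * (u - alpha * u).
  by rewrite mulrBr mulKf// gt_eqF.
by rewrite ler_pM2l ?invr_gt0// ltW.
Qed.

(** * Boxes of lattice points *)

(** The offset [b] gives a box of side [l] and its enlargement by [N] on every side the same form,
    the latter with offset [N] and side [l + N + N]. *)
Definition lattice_box n (b l : nat) : seq 'rV[int]_n :=
  [seq \row_i ((t i)%:Z - b%:Z) | t : {ffun 'I_n -> 'I_l}].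

Lemma size_lattice_box n b l : size (lattice_box n b l) = (l ^ n)%N.
Proof. by rewrite size_map -cardE card_ffun !card_ord. Qed.

Lemma lattice_box_uniq n b l : uniq (lattice_box n b l).
Proof.
rewrite map_inj_uniq ?enum_uniq// => t u /rowP tu; apply/ffunP => i.
by apply/val_inj; have := tu i; rewrite !mxE => /addIr[].
Qed.

Lemma mem_lattice_box n b l (y : 'rV[int]_n) :
  (y \in lattice_box n b l) = [forall i, - b%:Z <= y 0 i < l%:Z - b%:Z].
Proof.
apply/mapP/forallP => [[t _ ->] i|yb].
  rewrite mxE; have := ltn_ord (t i).
  by move: (nat_of_ord (t i)) => m; lia.
(* [inord] needs a nonempty ordinal type; for [l] = 0 the box is empty unless [n] = 0. *)
case: l yb => [|l] yb.
  case: n y yb => [|n] y yb; last by have := yb ord0; lia.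
  by exists [ffun i => i]; [rewrite mem_enum|apply/rowP => -[]].
exists [ffun i => inord (absz (y 0 i + b%:Z))]; first by rewrite mem_enum.
apply/rowP => i; rewrite mxE ffunE; have := yb i.
move: (y 0 i) => z {}yb.
by rewrite inordK; lia.
Qed.

Lemma lattice_box_ball (R : realType) n l N (r : R) (x k : 'rV[int]_n) :
  0 < r -> r <= N%:R -> x \in lattice_box n 0 l -> k \in ball_fset n r ->
  x + k \in lattice_box n N (l + N + N).
Proof.
move=> r0 rN; rewrite !mem_lattice_box mem_ball_fset// => /forallP xl kr.
apply/forallP => i; have := xl i; rewrite mxE.
have : `|(k 0 i)%:~R| < N%:R :> R.
  apply: lt_le_trans rN; apply: le_lt_trans kr.
  by have := ler_coord_euclidean_norm (map_mx intr k : 'rV[R]_n) i; rewrite mxE.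
rewrite -[N%:R]/(N%:Z%:~R) -intr_norm ltr_int.
move: (x 0 i) (k 0 i) => u v; lia.
Qed.

(** * The action of Z^n by commuting transformations *)

Section Dynamics.
Context d (T : measurableType d) (R : realType) (mu : set T -> \bar R).
Implicit Types (f g : T -> T) (U V : invertible_mpt mu).

Lemma measure_preserving_id : measure_preserving mu id.
Proof. by split; [exact: measurable_id|]. Qed.

Lemma measure_preserving_comp f g : measure_preserving mu f ->
  measure_preserving mu g -> measure_preserving mu (f \o g).
Proof.
move=> [mf pf] [mg pg]; split; first exact: measurableT_comp.
move=> A mA; rewrite comp_preimage pg ?pf// -[X in measurable X]setTI.
exact: mf.
Qed.

Lemma measure_preserving_iter f k : measure_preserving mu f ->
  measure_preserving mu (iter k f).
Proof.
move=> pf; elim: k => [|k IHk]; first exact: measure_preserving_id.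
exact: (measure_preserving_comp pf IHk).
Qed.

Lemma mpt_pow_preserving U j : measure_preserving mu (mpt_pow U j).
Proof.
by case: j => k; apply: measure_preserving_iter;
  [exact: mpt_fun_preserving|exact: mpt_inv_preserving].
Qed.

Lemma mpt_powS U (j : int) w : mpt_pow U (1 + j) w = U (mpt_pow U j w).
Proof.
case: j => [k|k]; first by rewrite -PoszD add1n /= .
case: k => [|k]; first by rewrite /= mpt_invK.
have -> : 1 + Negz k.+1 = Negz k by lia.
by rewrite /= mpt_invK.
Qed.

Lemma mpt_powD U (i j : int) w :
  mpt_pow U (i + j) w = mpt_pow U i (mpt_pow U j w).
Proof.
elim/int_rec: i => [|k IHk|k IHk]; first by rewrite add0r.
  by rewrite -add1n PoszD -addrA !mpt_powS IHk.
(* Applying the injective [U] to both sides raises the exponents by one and returns to the induction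
   hypothesis. *)
apply: (can_inj (mpt_funK U)); rewrite -2!mpt_powS addrA.
by have -> : 1 + - k.+1%:Z = - k%:Z by lia.
Qed.

Lemma commute_mpt_pow U f j : (forall w, U (f w) = f (U w)) ->
  forall w, mpt_pow U j (f w) = f (mpt_pow U j w).
Proof.
move=> Uf; elim/int_rec: j => [//|k IHk|k IHk] w.
  by rewrite -add1n PoszD !mpt_powS IHk Uf.
apply: (can_inj (mpt_funK U)); rewrite Uf -2!mpt_powS.
by have -> : 1 + - k.+1%:Z = - k%:Z by lia.
Qed.

Variables (n : nat) (U : 'I_n -> invertible_mpt mu).

Lemma mpt_monomial_preserving j : measure_preserving mu (mpt_monomial U j).
Proof.
apply: (big_ind (measure_preserving mu)) => [|f g|i _].
- exact: measure_preserving_id.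
- exact: measure_preserving_comp.
- exact: mpt_pow_preserving.
Qed.

(** Commutativity makes the monomials an action of Z^n, so that a ball average at the orbit point of
    index x becomes a count over the translate of the ball by x. *)
Lemma mpt_monomialD j k w :
  (forall (i l : 'I_n) (w : T), U i (U l w) = U l (U i w)) ->
  mpt_monomial U (j + k) w = mpt_monomial U j (mpt_monomial U k w).
Proof.
move=> Ucomm.
have pow_comm i l a b v : mpt_pow (U i) a (mpt_pow (U l) b v) =
    mpt_pow (U l) b (mpt_pow (U i) a v).
  by apply: commute_mpt_pow => u; symmetry; apply: commute_mpt_pow.
rewrite /mpt_monomial; elim: (index_enum _) w => [|i s IHs] w.
  by rewrite !big_nil.
rewrite !big_cons /= mxE mpt_powD IHs; congr (mpt_pow _ _ _).
set v := (X in _ (_ X) = _).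
(* The power of [U i] with exponent [k 0 i] must pass the remaining product; commuting with it is
   stable under composition. *)
apply: (big_ind (fun f => forall v, mpt_pow (U i) (k 0 i) (f v) =
  f (mpt_pow (U i) (k 0 i) v))) => // f g fE gE u.
by rewrite /= fE gE.
Qed.

End Dynamics.

(** * Orbit counts and truncated superlevel sets *)

Section Transference.
Context d (T : measurableType d) (R : realType) (mu : probability T R).
Context n (U : 'I_n -> invertible_mpt mu).

Definition visits (A : set T) (q : seq 'rV[int]_n) (w : T) : R :=
  (count (fun x => mpt_monomial U x w \in A) q)%:R.

Lemma visitsE A q w : visits A q w = \sum_(x <- q) \1_A (mpt_monomial U x w).
Proof.
rewrite /visits -sum1_count big_mkcond natr_sum; apply: eq_bigr => x _.
by rewrite indicE; case: (_ \in _).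
Qed.

Lemma visits_ge0 A q w : 0 <= visits A q w.
Proof. by []. Qed.

Lemma measurable_monomial_preimage A x : measurable A ->
  measurable (mpt_monomial U x @^-1` A).
Proof.
move=> mA; rewrite -[X in measurable X]setTI.
exact: (mpt_monomial_preserving U x).1.
Qed.

Lemma measurable_visits A q : measurable A ->
  measurable_fun setT (visits A q).
Proof.
move=> mA.
rewrite (_ : visits A q =
  fun w => \sum_(x <- q) \1_A (mpt_monomial U x w)); last first.
  by apply/funext => w; exact: visitsE.
apply: measurable_sum => x.
exact: (measurable_indic (measurable_monomial_preimage x mA)).
Qed.

(** By invariance of the measure, each index in [q] contributes [mu A]. *)
Lemma integral_visits A q : measurable A ->
  (\int[mu]_w (visits A q w)%:E = (size q)%:R%:E * mu A)%E.
Proof.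
move=> mA; have mU x := measurable_monomial_preimage x mA.
under eq_integral do rewrite visitsE -sumEFin.
rewrite ge0_integral_sum//; last first.
  move=> x; apply/measurable_EFinP; exact: (measurable_indic (mU x)).
transitivity (\sum_(x <- q) mu A)%E.
  apply: eq_bigr => x _.
  have -> : (fun w => (\1_A (mpt_monomial U x w))%:E) =
    (fun w => (\1_(mpt_monomial U x @^-1` A) w : R)%:E) by [].
  rewrite integral_indic// setIT.
  exact: (mpt_monomial_preserving U x).2.
rewrite -(fineK (fin_num_measure mu A mA)) sumEFin big_const_seq count_predT.
by rewrite iter_addr_0 -EFinM mulr_natl.
Qed.

(** Truncating the radii at [rho] keeps all balls centered in a box inside an enlargement by a fixed
    amount, as transference requires. *)
Definition superlevel (E : set T) (alpha rho : R) : set T :=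
  [set w | exists r, [/\ 0 < r, r <= rho &
    alpha * #|` ball_fset n r|%:R < visits E (ball_fset n r) w]].

(** The radii are uncountable, but they produce only countably many finite sets of lattice points;
    the union is regrouped along these. *)
Lemma measurable_superlevel E alpha rho : measurable E ->
  measurable (superlevel E alpha rho).
Proof.
move=> mE; pose G (F : {fset 'rV[int]_n}) : set T :=
  [set w | (exists r : R, [/\ 0 < r, r <= rho & F = ball_fset n r]) /\
    alpha * #|` F|%:R < visits E F w].
have -> : superlevel E alpha rho = \bigcup_F G F.
  apply/seteqP; split => [w [r [r0 rr h]]|w [F _ [[r [r0 rr ->]] h]]].
    by exists (ball_fset n r) => //; split => //; exists r.
  by exists r.
apply: countable_bigcupT_measurable => [|F]; first exact: countableP.
have [hF|hF] := pselect
  (exists r : R, [/\ 0 < r, r <= rho & F = ball_fset n r]).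
  rewrite (_ : G F = visits E F @^-1` `]alpha * #|` F|%:R, +oo[).
    by rewrite -[X in measurable X]setTI; exact: measurable_visits.
  by apply/seteqP; split => w /=; rewrite in_itv/= andbT; [case|split].
by rewrite (_ : G F = set0)// -subset0 => w [].
Qed.

End Transference.

(** * Comparison of large boxes *)

Lemma bernoulli_ler (R : realType) n (x : R) :
  0 <= x -> x <= 1 -> 1 - n%:R * (1 - x) <= x ^+ n.
Proof.
move=> x0 x1; elim: n => [|n IHn]; first by rewrite mul0r subr0 expr0.
rewrite exprS -natr1; have : 0 <= x ^+ n <= 1 by rewrite exprn_ge0 ?exprn_ile1.
have : 0 <= n%:R :> R by [].
by move: (x ^+ n) (n%:R) IHn => y m; nra.
Qed.

(** The ratio (l / (l + m))^n tends to 1 as l grows. Bernoulli's inequality makes this quantitative,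
    so one explicit l refutes b < a. *)
Lemma ler_of_box_ratio (R : realType) n m (a b : R) : 0 <= a ->
  (forall l, (l ^ n)%:R * a <= ((l + m) ^ n)%:R * b) -> a <= b.
Proof.
move=> a0 ab; rewrite leNgt; apply/negP => ba.
have ba0 : 0 < a - b by rewrite subr_gt0.
(* This l satisfies n m a < l (a - b), which forces a (1 - n m / (l + m)) > b. *)
pose l := Num.Def.archi_bound (n%:R * m%:R * a / (a - b)).
have ln : n%:R * m%:R * a < l%:R * (a - b).
  by rewrite -ltr_pdivrMr// archi_boundP// divr_ge0 ?mulr_ge0// ltW.
have l0 : 0 < l%:R :> R.
  by rewrite -(pmulr_lgt0 _ ba0) (le_lt_trans _ ln)// !mulr_ge0.
have lm0 : 0 < l%:R + m%:R :> R by rewrite ltr_wpDr.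
have := ab l; rewrite !natrX natrD.
rewrite mulrC (mulrC _ b) -ler_pdivrMr ?exprn_gt0// -mulrA -expr_div_n.
apply/negP; rewrite -ltNge.
have x1 : l%:R / (l%:R + m%:R) <= 1 :> R by rewrite ler_pdivrMr// mul1r lerDl.
have x0 : 0 <= l%:R / (l%:R + m%:R) :> R by rewrite divr_ge0// ltW.
apply: lt_le_trans (ler_wpM2l a0 (bernoulli_ler n x0 x1)).
have -> : 1 - l%:R / (l%:R + m%:R) = m%:R / (l%:R + m%:R) :> R.
  by field; rewrite gt_eqF.
rewrite -subr_gt0.
have -> : a * (1 - n%:R * (m%:R / (l%:R + m%:R))) - b =
    ((l%:R + m%:R) * (a - b) - n%:R * m%:R * a) / (l%:R + m%:R).
  by field; rewrite gt_eqF.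
rewrite divr_gt0// subr_gt0 (lt_le_trans ln)// ler_wpM2r ?lerDl//.
exact: ltW.
Qed.

(** * Transference and bounds for the Tauberian constant *)

Section MaximalTheorem.
Context d (T : measurableType d) (R : realType) (mu : probability T R).
Context n (U : 'I_n -> invertible_mpt mu).
Hypothesis n_gt0 : (0 < n)%N.
Hypothesis Ucomm :
  forall (i k : 'I_n) (w : T), U i (U k w) = U k (U i w).

Definition overlap_bound : R := ((2 * n).+1 ^ n)%:R.

Lemma measure_superlevelD E (alpha : R) N : measurable E ->
  0 < alpha -> alpha < 1 ->
  (mu (superlevel U E alpha N%:R `\` E) <=
   (overlap_bound * (alpha^-1 - 1))%:E * mu E)%E.
Proof.
move=> mE a0 a1; set S := _ `\` E; set c := _ * _.
have c0 : 0 <= c by rewrite mulr_ge0// subr_ge0 invf_ge1// ltW.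
have mS : measurable S by apply: measurableD => //; exact: measurable_superlevel.
(* The lattice estimate along the orbit of [w]: [s] collects the indices in the small box that visit
   [S], and [q] is the box enlarged by [N]. *)
have pointwise l w : visits U S (lattice_box n 0 l) w <=
    c * visits U E (lattice_box n N (l + N + N)) w.
  rewrite /visits -size_filter; apply: lattice_tauberian => //.
  - by rewrite filter_uniq// lattice_box_uniq.
  - exact: lattice_box_uniq.
  move=> x; rewrite mem_filter => /andP[xS xl]; move: xS.
  rewrite inE => -[[r [r0 rN hr]] nE]; split; first by apply/negP; rewrite inE.
  exists r; split => //.
    by move=> k kr; exact: lattice_box_ball r0 rN xl kr.
  apply: lt_le_trans hr _; rewrite /visits ler_nat.
  by apply: sub_count => k; rewrite addrC mpt_monomialD.
clearbody c.
have mfin A : measurable A -> mu A = (fine (mu A))%:E.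
  by move=> mA; rewrite fineK// fin_num_measure.
rewrite (mfin S)// (mfin E)// -EFinM lee_fin.
(* The pointwise bound is to be integrated; the sides differ by 2N, fixed while [l] grows. *)
apply: (@ler_of_box_ratio _ n (N + N)) => [|l]; first exact/fine_ge0/measure_ge0.
rewrite -lee_fin mulrCA 3!EFinM -!mfin// addnA.
rewrite -(size_lattice_box n 0) -(size_lattice_box n N) -!(integral_visits U)//.
have mv A q : measurable A -> measurable_fun setT (EFin \o visits U A q).
  by move=> mA; apply/measurable_EFinP; exact: measurable_visits.
have v0 A q w : (0 <= (visits U A q w)%:E)%E by rewrite lee_fin visits_ge0.
rewrite -ge0_integralZl_EFin//; last exact: mv.
apply: ge0_le_integral => //; first exact: mv.
  by apply: measurable_funeM; exact: mv.
by move=> w _; rewrite -EFinM lee_fin.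
Qed.

Lemma ergodic_avg_indic E r w : 0 < r ->
  ergodic_avg U \1_E (origin_ball r) w =
  #|` ball_fset n r|%:R^-1 * visits U E (ball_fset n r) w.
Proof.
move=> r0; rewrite /ergodic_avg -/(ball_fset n r) fsbig_finite/=; last first.
  exact/finite_lattice_points/HLc_origin_ball.
by rewrite visitsE; under eq_bigr do rewrite ger0_norm//.
Qed.

Lemma card_ball_fset_gt0 (r : R) : 0 < r -> (0 < #|` ball_fset n r|)%N.
Proof.
move=> r0; rewrite cardfs_gt0; apply/fset0Pn; exists 0.
by rewrite mem_ball_fset// raddf0 -(subrr 0) euclidean_dist0.
Qed.

(** A supremum exceeds [alpha] exactly when a single average does, and the radius of that ball lies
    below some integer. *)
Lemma maximal_superlevelE E (alpha : R) :
  [set w | (alpha%:E < ergodic_maximal_HLc U \1_E w)%E] =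
  \bigcup_N superlevel U E alpha N%:R.
Proof.
apply/seteqP; split => [w|w [N _ [r [r0 _ h]]]].
  move=> /ereal_sup_gt[_ [_ [r r0 ->] <-]]; rewrite lte_fin.
  rewrite -/(origin_ball r) ergodic_avg_indic// mulrC.
  rewrite ltr_pdivlMr ?ltr0n ?card_ball_fset_gt0// => h.
  exists (Num.Def.archi_bound r) => //; exists r; split => //.
  exact/ltW/archi_boundP/ltW.
apply: (@lt_le_trans _ _ (ergodic_avg U \1_E (origin_ball r) w)%:E).
  rewrite lte_fin ergodic_avg_indic// mulrC.
  by rewrite ltr_pdivlMr ?ltr0n ?card_ball_fset_gt0.
apply: ereal_sup_ubound; exists (origin_ball r) => //.
exact: HLc_origin_ball.
Qed.

(** Continuity from below carries the bound off [E] from the truncated sets to their increasing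
    union; [E] itself accounts for the summand 1. *)
Lemma measure_maximal_le E (alpha : R) : measurable E ->
  0 < alpha -> alpha < 1 ->
  (mu [set w | alpha%:E < ergodic_maximal_HLc U \1_E w] <=
   (1 + overlap_bound * (alpha^-1 - 1))%:E * mu E)%E.
Proof.
move=> mE a0 a1; rewrite maximal_superlevelE.
set F := fun N : nat => superlevel U E alpha N%:R.
have mF N : measurable (F N) by exact: measurable_superlevel.
have mFE N : measurable (F N `\` E) by exact: measurableD.
have mUFE : measurable (\bigcup_N (F N `\` E)) by exact: bigcupT_measurable.
have FED : (mu (\bigcup_N (F N `\` E)) <=
            (overlap_bound * (alpha^-1 - 1))%:E * mu E)%E.
  have cv : mu (F N `\` E) @[N --> \oo] --> mu (\bigcup_N (F N `\` E)).
    apply: nondecreasing_cvg_mu => // p q pq; apply/subsetPset.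
    apply: setSD => w [r [r0 rp h]]; exists r; split => //.
    by rewrite (le_trans rp)// ler_nat.
  rewrite -(cvg_lim _ cv)//; apply: lime_le; first exact: cvgP cv.
  by apply: nearW => N; exact: measure_superlevelD.
rewrite EFinD muleDl ?fin_num_measure// mul1e.
apply: (@le_trans _ _ (mu (E `|` \bigcup_N (F N `\` E)))).
  apply: le_measure; rewrite ?inE//.
  - exact: bigcupT_measurable.
  - exact: measurableU.
  move=> w [N _ FNw]; have [Ew|nEw] := pselect (E w); first by left.
  by right; exists N.
by rewrite (le_trans (measureU2 mu mE mUFE))// leeD2l.
Qed.

Lemma tauberian_HLc_le (alpha : R) : 0 < alpha -> alpha < 1 ->
  (tauberian_HLc U alpha <= (1 + overlap_bound * (alpha^-1 - 1))%:E)%E.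
Proof.
move=> a0 a1; apply: ge_ereal_sup => _ [E [mE E0] <-].
have := measure_maximal_le mE a0 a1.
have Efin : mu E = (fine (mu E))%:E by rewrite fineK// fin_num_measure.
move: E0; rewrite Efin lte_fin => e0.
by rewrite inver gt_eqF// lee_pdivrMr.
Qed.

(** The whole space serves as test set: all averages of its indicator equal 1. *)
Lemma tauberian_HLc_ge1 (alpha : R) : alpha < 1 ->
  (1 <= tauberian_HLc U alpha)%E.
Proof.
move=> a1; apply: le_ereal_sup_tmp.
exists (mu [set w | alpha%:E < ergodic_maximal_HLc U \1_setT w] / mu setT)%E.
  by exists setT => //; split => //; rewrite probability_setT.
rewrite (_ : [set w | _] = setT) ?probability_setT ?inve1 ?mule1//.
rewrite maximal_superlevelE -subTset => w _; exists 1%N => //.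
exists 1; split => //; have c0 := card_ball_fset_gt0 ltr01.
rewrite /visits (_ : count _ _ = #|` ball_fset n (1 : R)|%N).
  by rewrite gtr_pMl// ltr0n.
by rewrite -[RHS]count_predT; apply: eq_count => k; rewrite /= in_setT.
Qed.

End MaximalTheorem.

(** * Choice of constants and the limit *)

Theorem theorem1p9 (R : realType) (n : nat) (n_ge1 : (1 <= n)%N) :
  exists (C_n alpha_n : R), [/\ 0 < C_n, 0 < alpha_n, alpha_n < 1 &
    forall (d : measure_display) (Omega : measurableType d)
           (mu : probability Omega R) (U : 'I_n -> invertible_mpt mu),
      (forall (i k : 'I_n) (w : Omega), U i (U k w) = U k (U i w)) ->
      (tauberian_HLc U alpha @[alpha --> 1^'-] --> 1%E) /\
      (forall alpha : R, alpha_n < alpha -> alpha < 1 ->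
         (tauberian_HLc U alpha - 1%E <= (C_n * (alpha^-1 - 1))%:E)%E)].
Proof.
have h0 : 0 < 2^-1 :> R by rewrite invr_gt0.
have h1 : 2^-1 < 1 :> R by rewrite invf_lt1// ltr1n.
(* [C_n] is the Besicovitch overlap bound. The estimate of [tauberian_HLc_le] covers all of (0, 1),
   and 1/2 is a convenient threshold there. *)
exists (overlap_bound R n), 2^-1; split => //; first by rewrite ltr0n expn_gt0.
move=> d Omega mu U Ucomm; split; last first.
  move=> alpha ha a1; have a0 := lt_trans h0 ha.
  rewrite leeBlDl//; apply: le_trans (tauberian_HLc_le n_ge1 Ucomm a0 a1) _.
  by rewrite EFinD.
pose bound (alpha : R) := (1 + overlap_bound R n * (alpha^-1 - 1))%:E.
(* The constant lies between 1 and [bound], which is continuous at 1 with value 1. *)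
apply: (@squeeze_cvge _ _ _ _ (cst 1%E) _ bound).
- near=> alpha; have a1 : alpha < 1 by near: alpha; exact: nbhs_left_lt.
  have a0 : 0 < alpha by near: alpha; exact: nbhs_left_gt.
  by rewrite tauberian_HLc_ge1//= tauberian_HLc_le.
- exact: cvg_cst.
apply: cvg_EFin; first by near=> alpha.
have : 1 + overlap_bound R n * (alpha^-1 - 1) @[alpha --> (1 : R)^'-] -->
    1 + overlap_bound R n * (1^-1 - 1).
  apply: cvg_at_left_filter; apply: cvgD; first exact: cvg_cst.
  apply: cvgM; first exact: cvg_cst.
  apply: cvgB; last exact: cvg_cst.
  by apply: inv_continuous; rewrite oner_eq0.
by rewrite invr1 subrr mulr0 addr0.
Unshelve. all: by end_near.
Qed.
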